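(* Let $P$ be an arbitrary set, let $\mathcal{L}^R\mathcal{S}$ be the category of the right strong monad freely generated by $P$ as set of generating objects, and let $\mathit{Fun}$ be the category of all functions between finite ordinals. Then the functor $G:\mathcal{L}^R\mathcal{S}\to\mathit{Fun}$ defined in the context is faithful; i.e. for all objects $A,B$ and all arrows $f,g:A\to B$ of $\mathcal{L}^R\mathcal{S}$, if $Gf=Gg$, then $f=g$.
   Context: A monoidal category has a bifunctor $\otimes$, a unit object $I$ and natural isomorphisms $a_{A,B,C}:(A\otimes B)\otimes C\to A\otimes(B\otimes C)$, $l_A:I\otimes A\to A$, $r_A:A\otimes I\to A$ satisfying the usual coherence conditions. $\mathbf 1_A$ denotes the identity arrow of $A$. A right strong monad in a monoidal category $\mathcal A$ is a monad $\langle T,\eta,\mu\rangle$ in $\mathcal A$ (with $\eta_A:A\to TA$, $\mu_A:TTA\to TA$) together with a natural transformation with components $\psi^R_{A,B}:A\otimes TB\to T(A\otimes B)$ such that - $Ta_{A,B,C}\circ\psi^R_{A\otimes B,C}=\psi^R_{A,B\otimes C}\circ(\mathbf 1_A\otimes\psi^R_{B,C})\circ a_{A,B,TC}$, - $Tl_A\circ\psi^R_{I,A}=l_{TA}$, - $\psi^R_{A,B}\circ(\mathbf 1_A\otimes\eta_B)=\eta_{A\otimes B}$, - $\psi^R_{A,B}\circ(\mathbf 1_A\otimes\mu_B)=\mu_{A\otimes B}\circ T\psi^R_{A,B}\circ\psi^R_{A,TB}$. $\mathcal{L}^R\mathcal{S}$ is the free such structure on $P$: its objects are the formal expressions built from elements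 of $P$ and $I$ by $\otimes$ and $T$; its arrows are arrow terms built from identities, $a,a^{-1},l,l^{-1},r,r^{-1},\eta,\mu,\psi^R$ by $\circ$, $\otimes$ and $T$, modulo the congruence generated by the equations of categories, functoriality, naturality, monoidal categories, monads, and the four equations above. $\mathit{Fun}$ has as objects the finite ordinals $n=\{0,\dots,n-1\}$ and as arrows arbitrary functions between them. The functor $G$: $GA$ is the number of occurrences of $T$ in $A$; the elements $0,\dots,GA-1$ of $GA$ correspond to the occurrences of $T$ in $A$ counted from right to left. On arrow terms: $G$ of an identity and of $a_{A,B,C}$, $l_A$, $r_A$ and their inverses is the identity function; $G\psi^R_{A,B}$ is the bijection that sends the occurrence of $T$ immediately in front of $B$ in the source $A\otimes TB$ to the outermost (leftmost) occurrence of $T$ in the target $T(A\otimes B)$, and sends every occurrence of $T$ inside $A$, respectively inside $B$, to the corresponding occurrence inside $A$, respectively $B$; $G\eta_A:GA\to GA+1$ is $i\mapsto i$; $G\mu_A:GA+2\to GA+1$ is $i\mapsto i$ for $i\le GA$ and $GA+1\mapsto GA$; $G(f\otimes g)$ is the juxtaposition of $Gf$ (on the left, i.e. on the larger elements) and $Gg$ (on the right, i.e. on the smaller elements); $GTf$ extends $Gf$ by sending the new leftmost (greatest) element of the source to the new leftmost (greatest) element of the target; $G(g\circ f)=Gg\circ Gf$. *)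

(* Defs.v *)
From HB Require Import structures.
From mathcomp Require Import all_boot boolp zify.

Set Implicit Arguments.
Unset Strict Implicit.
Unset Printing Implicit Defensive.

Record category := Category {
  ob :> Type;
  hom : ob -> ob -> Type;
  idm : forall A, hom A A;
  comp : forall A B C, hom B C -> hom A B -> hom A C;
  comp_idl : forall A B (f : hom A B), comp (idm B) f = f;
  comp_idr : forall A B (f : hom A B), comp f (idm A) = f;
  compA : forall A B C D (h : hom C D) (g : hom B C) (f : hom A B),
    comp h (comp g f) = comp (comp h g) f }.

Record functor (C D : category) := Functor {
  fob :> ob C -> ob D;
  fmap : forall A B : C, hom A B -> hom (fob A) (fob B);
  fmap_id : forall A : C, fmap (idm A) = idm (fob A);
  fmap_comp : forall (A B E : C) (g : hom B E) (f : hom A B),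
    fmap (comp g f) = comp (fmap g) (fmap f) }.

Definition faithful (C D : category) (F : functor C D) : Prop :=
  forall (A B : C) (f g : hom A B), fmap F f = fmap F g -> f = g.

(* Finite functions compare by Leibniz equality exactly when they agree
   pointwise (ffunP). *)
Definition Fun : category.
Proof.
refine (@Category nat (fun m n => {ffun 'I_m -> 'I_n})
  (fun n => [ffun i => i]) (fun _ _ _ g f => [ffun i => g (f i)]) _ _ _).
- by move=> A B f; apply/ffunP=> i; rewrite !ffunE.
- by move=> A B f; apply/ffunP=> i; rewrite !ffunE.
- by move=> A B C D h g f; apply/ffunP=> i; rewrite !ffunE.
Defined.

Reserved Notation "A ** B" (at level 38, left associativity).
Reserved Notation "f *** g" (at level 38, left associativity).
Reserved Notation "g \oo f" (at level 45, right associativity).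
Reserved Notation "f === g" (at level 70, no associativity).

Section RightStrongMonadLanguage.

Variable P : Type.

Inductive obj : Type :=
| Gen of P
| Unit
| Tensor of obj & obj
| T of obj.

Local Notation "A ** B" := (Tensor A B).

Inductive term : obj -> obj -> Type :=
| Id A : term A A
| Comp A B C : term B C -> term A B -> term A C
| TensorM A B C D : term A B -> term C D -> term (A ** C) (B ** D)
| TM A B : term A B -> term (T A) (T B)
| Assoc A B C : term ((A ** B) ** C) (A ** (B ** C))
| AssocV A B C : term (A ** (B ** C)) ((A ** B) ** C)
| Lunit A : term (Unit ** A) A
| LunitV A : term A (Unit ** A)
| Runit A : term (A ** Unit) A
| RunitV A : term A (A ** Unit)
| Eta A : term A (T A)
| Mu A : term (T (T A)) (T A)
| Psi A B : term (A ** T B) (T (A ** B)).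

Local Notation "g \oo f" := (Comp g f).
Local Notation "f *** g" := (TensorM f g).

Inductive term_eq : forall A B, term A B -> term A B -> Prop :=
| te_refl A B (f : term A B) : f === f
| te_sym A B (f g : term A B) : f === g -> g === f
| te_trans A B (f g h : term A B) : f === g -> g === h -> f === h
| te_comp A B C (g g' : term B C) (f f' : term A B) :
    g === g' -> f === f' -> g \oo f === g' \oo f'
| te_tensor A B C D (f f' : term A B) (g g' : term C D) :
    f === f' -> g === g' -> f *** g === f' *** g'
| te_T A B (f f' : term A B) : f === f' -> TM f === TM f'
| te_idl A B (f : term A B) : Id B \oo f === f
| te_idr A B (f : term A B) : f \oo Id A === f
| te_compA A B C D (h : term C D) (g : term B C) (f : term A B) :
    h \oo (g \oo f) === (h \oo g) \oo f
| te_tensor_id A B : Id A *** Id B === Id (A ** B)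
| te_tensor_comp A1 B1 C1 A2 B2 C2 (g1 : term B1 C1) (f1 : term A1 B1)
    (g2 : term B2 C2) (f2 : term A2 B2) :
    (g1 \oo f1) *** (g2 \oo f2) === (g1 *** g2) \oo (f1 *** f2)
| te_T_id A : TM (Id A) === Id (T A)
| te_T_comp A B C (g : term B C) (f : term A B) :
    TM (g \oo f) === TM g \oo TM f
| te_assoc_nat A A' B B' C C'
    (f : term A A') (g : term B B') (h : term C C') :
    (f *** (g *** h)) \oo Assoc A B C === Assoc A' B' C' \oo ((f *** g) *** h)
| te_lunit_nat A A' (f : term A A') :
    f \oo Lunit A === Lunit A' \oo (Id Unit *** f)
| te_runit_nat A A' (f : term A A') :
    f \oo Runit A === Runit A' \oo (f *** Id Unit)
| te_eta_nat A A' (f : term A A') : TM f \oo Eta A === Eta A' \oo f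
| te_mu_nat A A' (f : term A A') : TM f \oo Mu A === Mu A' \oo TM (TM f)
| te_psi_nat A A' B B' (f : term A A') (g : term B B') :
    TM (f *** g) \oo Psi A B === Psi A' B' \oo (f *** TM g)
(* Naturality of the inverses follows from the isomorphism equations, and
   Lunit Unit === Runit Unit from the pentagon and the triangle. *)
| te_assocK A B C : AssocV A B C \oo Assoc A B C === Id ((A ** B) ** C)
| te_assocVK A B C : Assoc A B C \oo AssocV A B C === Id (A ** (B ** C))
| te_lunitK A : LunitV A \oo Lunit A === Id (Unit ** A)
| te_lunitVK A : Lunit A \oo LunitV A === Id A
| te_runitK A : RunitV A \oo Runit A === Id (A ** Unit)
| te_runitVK A : Runit A \oo RunitV A === Id A
| te_pentagon A B C D :
    Assoc A B (C ** D) \oo Assoc (A ** B) C D ===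
    (Id A *** Assoc B C D) \oo (Assoc A (B ** C) D \oo (Assoc A B C *** Id D))
| te_triangle A B :
    (Id A *** Lunit B) \oo Assoc A Unit B === Runit A *** Id B
| te_mu_etaT A : Mu A \oo Eta (T A) === Id (T A)
| te_mu_Teta A : Mu A \oo TM (Eta A) === Id (T A)
| te_mu_mu A : Mu A \oo Mu (T A) === Mu A \oo TM (Mu A)
| te_psi_assoc A B C :
    TM (Assoc A B C) \oo Psi (A ** B) C ===
    Psi A (B ** C) \oo ((Id A *** Psi B C) \oo Assoc A B (T C))
| te_psi_lunit A : TM (Lunit A) \oo Psi Unit A === Lunit (T A)
| te_psi_eta A B : Psi A B \oo (Id A *** Eta B) === Eta (A ** B)
| te_psi_mu A B :
    Psi A B \oo (Id A *** Mu B) ===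
    Mu (A ** B) \oo (TM (Psi A B) \oo Psi A (T B))
where "f === g" := (term_eq f g).

Section Quotient.

Variables A B : obj.

(* Equality of terms is reflected classically into bool, as required by the
   quotient construction. *)
Definition term_eqb : rel (term A B) := fun f g => `[< f === g >].

Fact term_eqb_refl : reflexive term_eqb.
Proof. by move=> f; apply/asboolP; apply: te_refl. Qed.

Fact term_eqb_sym : symmetric term_eqb.
Proof. by move=> f g; apply/asboolP/asboolP; apply: te_sym. Qed.

Fact term_eqb_trans : transitive term_eqb.
Proof.
move=> g f h /asboolP fg /asboolP gh; apply/asboolP.
exact: te_trans fg gh.
Qed.

HB.instance Definition _ := gen_eqMixin (term A B).
HB.instance Definition _ := gen_choiceMixin (term A B).

Canonical term_equiv :=
  EquivRel term_eqb term_eqb_refl term_eqb_sym term_eqb_trans.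

Definition arrow : Type := {eq_quot term_equiv}%qT.

Definition class (f : term A B) : arrow := (\pi_({eq_quot term_equiv}) f)%qT.

Definition rep (f : arrow) : term A B := repr (f : {eq_quot term_equiv}%qT).

Lemma classP (f g : term A B) : class f = class g <-> f === g.
Proof.
split; first by move/eqmodP/asboolP.
by move=> fg; apply/eqmodP/asboolP.
Qed.

Lemma repK (f : arrow) : class (rep f) = f.
Proof. exact: reprK. Qed.

Lemma class_repK (f : term A B) : rep (class f) === f.
Proof. by apply/classP; rewrite repK. Qed.

End Quotient.

Definition arrow_comp A B C (g : arrow B C) (f : arrow A B) : arrow A C :=
  class (rep g \oo rep f).

Lemma class_comp A B C (g : term B C) (f : term A B) :
  arrow_comp (class g) (class f) = class (g \oo f).
Proof. by apply/classP/te_comp; apply: class_repK. Qed.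

Definition LRS : category.
Proof.
refine (@Category obj arrow (fun A => class (Id A)) arrow_comp _ _ _).
- by move=> A B f; rewrite -(repK f) class_comp; apply/classP/te_idl.
- by move=> A B f; rewrite -(repK f) class_comp; apply/classP/te_idr.
- move=> A B C D h g f; rewrite -(repK h) -(repK g) -(repK f) !class_comp.
  exact/classP/te_compA.
Defined.

Fixpoint Gob (A : obj) : nat :=
  match A with
  | Gen _ | Unit => 0
  | A ** B => Gob A + Gob B
  | T A => (Gob A).+1
  end.

(* The underlying function on numbers; only its values at i < Gob A matter.
   Occurrences of T are numbered from right to left, so in A ** B those of B
   come first, and in T A the outermost T is number Gob A. *)
Fixpoint Gval A B (f : term A B) : nat -> nat :=
  match f with
  | Comp _ _ _ g f => fun i => Gval g (Gval f i)
  | TensorM _ _ C D f g => fun i =>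
      if i < Gob C then Gval g i else Gval f (i - Gob C) + Gob D
  | TM A B f => fun i => if i < Gob A then Gval f i else Gob B
  | Mu A => fun i => if i <= Gob A then i else Gob A
  | Psi A B => fun i =>
      if i < Gob B then i
      else if i == Gob B then Gob A + Gob B
      else i.-1
  | _ => id
  end.

Local Ltac case_ifs := repeat match goal with
  | |- context [if ?b then _ else _] =>
    lazymatch b with context [if _ then _ else _] => fail | _ => idtac end;
    let e := fresh "e" in case e : b
  end.

Lemma Gval_lt A B (f : term A B) i : i < Gob A -> Gval f i < Gob B.
Proof.
elim: f i => /=; try by move=> *; case_ifs; lia.
- by move=> A0 B0 C g IHg f IHf i lti; apply/IHg/IHf.
- move=> A0 B0 C D f IHf g IHg i lti; have := IHg i; have := IHf (i - Gob C).
  by case_ifs; lia.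
- by move=> A0 B0 f IHf i lti; have := IHf i; case_ifs; lia.
Qed.

Definition Gterm A B (f : term A B) : {ffun 'I_(Gob A) -> 'I_(Gob B)} :=
  [ffun i => Ordinal (Gval_lt f (ltn_ord i))].

Lemma Gval_eq A B (f g : term A B) :
  f === g -> forall i, i < Gob A -> Gval f i = Gval g i.
Proof.
elim=> {A B f g} /=; try by move=> *; case_ifs; lia.
- by move=> A B f g _ IH i /IH.
- by move=> A B f g h _ IH1 _ IH2 i lti; rewrite IH1 ?IH2.
- move=> A B C g g' f f' _ IH1 _ IH2 i lti.
  by rewrite IH2 // IH1 // Gval_lt.
- move=> A B C D f f' g g' _ IH1 _ IH2 i lti.
  by have := IH2 i; have := IH1 (i - Gob C); case_ifs; lia.
- by move=> A B f f' _ IH i lti; have := IH i; case_ifs; lia.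
- move=> A1 B1 C1 A2 B2 C2 g1 f1 g2 f2 i lti.
  have := @Gval_lt _ _ f2 i; case: (ltnP i (Gob A2)) => [_ -> //|_ _].
  by rewrite ltnNge leq_addl addnK.
- move=> A B C g f i lti.
  have := @Gval_lt _ _ f i; case: (ltnP i (Gob A)) => [_ -> //|_ _].
  by rewrite ltnn.
- move=> A A' B B' C C' f g h i lti.
  by have := subnDA (Gob C) i (Gob B); rewrite addnC => ->; case_ifs; lia.
- by move=> A A' f i lti; rewrite subn0 addn0.
- move=> A A' f i lti; have := @Gval_lt _ _ f i.
  by case: (ltngtP i (Gob A)) => [|| ->] * /=; case_ifs; lia.
- move=> A A' B B' f g i lti; have := @Gval_lt _ _ g i.
  have := @Gval_lt _ _ f (i - (Gob B).+1).
  have E : i.-1 - Gob B = i - (Gob B).+1 by lia.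
  by case: (ltngtP i (Gob B)) => [|| ->] *; case_ifs; rewrite ?E; lia.
Qed.

Definition fmapG A B (f : arrow A B) : {ffun 'I_(Gob A) -> 'I_(Gob B)} :=
  Gterm (rep f).

Lemma fmapG_class A B (f : term A B) : fmapG (class f) = Gterm f.
Proof.
apply/ffunP=> i; rewrite !ffunE; apply: val_inj => /=.
exact: Gval_eq (class_repK f) _ (ltn_ord i).
Qed.

Definition G : functor LRS Fun.
Proof.
refine (@Functor LRS Fun Gob fmapG _ _) => /=.
- move=> A; rewrite fmapG_class; apply/ffunP=> i; rewrite !ffunE.
  exact: val_inj.
- move=> A B E g f; rewrite -{1}(repK g) -{1}(repK f) class_comp fmapG_class.
  by apply/ffunP=> i; rewrite !ffunE; apply: val_inj.
Defined.

End RightStrongMonadLanguage.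

(* Main.v *)
From Stdlib Require Import Setoid Morphisms.
From mathcomp Require Import all_boot boolp zify.
Require Import Defs.

Set Implicit Arguments.
Unset Strict Implicit.
Unset Printing Implicit Defensive.

(** Up to the associativity and unit isomorphisms an object is a word whose
    letters are generators and blocks [T w], with [w] a word.  In this picture
    [Eta] encloses a stretch of letters in a block, [Mu] merges two blocks with
    the same extent, and [Psi] extends a block to the left.  Each of these has
    a single block as target, so an arrow into a product of words splits into
    a product of arrows.  An arrow into a single block [T v] is either
    [Eta v \oo f], when nothing is sent to the outermost [T] of the target, or
    else the last letter of the source is a block [T w] whose [T] is sent
    there, and the arrow is the extension
    [ext f = Mu \oo TM f \oo Psi] of an arrow [f] whose source has that [T]
    removed.

    The predicate [normal] describes the arrow terms built by these rules
    alone.  Every term is normal ([term_normal]); the substance of this is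
    closure under composition ([normal_comp]), a cut elimination in which two
    successive extensions are merged by [ext_ext].  On the other hand [G]
    determines which rule was used last and the data it was applied to, so
    normal terms with the same image are equal ([normal_unique]).  For a
    product the data are the splitting of the source word, which [G] recovers
    by counting occurrences of [T] and of generators; for an extension [ext f]
    one gets [f] back by composing with [Id *** Eta] ([ext_eta]).  The freedom
    left is in the bracketing, and it is settled by coherence for monoidal
    categories ([structural_unique], [structural_exists]), with blocks treated
    as atoms. *)

Section Faithfulness.

(** * Rewriting in the free right strong monad *)

Variable P : Type.

Local Notation obj := (obj P).
Local Notation term := (@term P).
Local Notation I := (Unit P).
Local Notation "A ** B" := (Tensor A B).
Local Notation "g \oo f" := (Comp g f).
Local Notation "f *** g" := (TensorM f g).
Local Notation "f === g" := (term_eq f g).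

#[local] Instance term_eq_equiv A B : Equivalence (@term_eq P A B).
Proof.
split; first exact: te_refl.
  by move=> f g; apply: te_sym.
by move=> f g h; apply: te_trans.
Qed.

#[local] Instance Comp_proper A B C :
  Proper (@term_eq P B C ==> @term_eq P A B ==> @term_eq P A C) (@Comp P A B C).
Proof. by move=> g g' eg f f' ef; apply: te_comp. Qed.

#[local] Instance TensorM_proper A B C D :
  Proper (@term_eq P A B ==> @term_eq P C D ==> @term_eq P (A ** C) (B ** D))
    (@TensorM P A B C D).
Proof. by move=> g g' eg f f' ef; apply: te_tensor. Qed.

#[local] Instance TM_proper A B :
  Proper (@term_eq P A B ==> @term_eq P (T A) (T B)) (@TM P A B).
Proof. by move=> f f' ef; apply: te_T. Qed.

#[local] Hint Resolve te_refl : core.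

(** Composites are kept nested to the right; the next three lemmas apply an
    equation between composites to the head of such a nest. *)
Lemma comp_eqr A B B' C (g : term B C) (f : term A B) (g' : term B' C)
    (f' : term A B') :
  g \oo f === g' \oo f' ->
  forall Z (h : term Z A), g \oo (f \oo h) === g' \oo (f' \oo h).
Proof. by move=> e Z h; rewrite te_compA e te_compA. Qed.

Lemma comp_eqr1 A B C (g : term B C) (f : term A B) (k : term A C) :
  g \oo f === k -> forall Z (h : term Z A), g \oo (f \oo h) === k \oo h.
Proof. by move=> e Z h; rewrite te_compA e. Qed.

Lemma comp_idK A B (g : term B A) (f : term A B) :
  g \oo f === Id A -> forall Z (h : term Z A), g \oo (f \oo h) === h.
Proof. by move=> e Z h; rewrite te_compA e te_idl. Qed.

Lemma tensor_idr A B C D (f : term A B) (g : term C D) :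
  (f *** Id D) \oo (Id A *** g) === f *** g.
Proof. by rewrite -te_tensor_comp te_idl te_idr. Qed.

Lemma tensor_idl A B C D (f : term A B) (g : term C D) :
  (Id B *** g) \oo (f *** Id C) === f *** g.
Proof. by rewrite -te_tensor_comp te_idl te_idr. Qed.

Lemma tensor_compr A B C D E (f : term A B) (g : term D E) (h : term C D) :
  f *** (g \oo h) === (Id B *** g) \oo (f *** h).
Proof. by rewrite -te_tensor_comp te_idl. Qed.

Lemma unit_tensor_inj A B (f g : term A B) :
  Id I *** f === Id I *** g -> f === g.
Proof.
move=> e; rewrite -(te_idr f) -(te_idr g) -(te_lunitVK A) !te_compA.
by rewrite !te_lunit_nat e.
Qed.

Lemma tensor_unit_inj A B (f g : term A B) :
  f *** Id I === g *** Id I -> f === g.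
Proof.
move=> e; rewrite -(te_idr f) -(te_idr g) -(te_runitVK A) !te_compA.
by rewrite !te_runit_nat e.
Qed.

(** Kelly's derivation of this coherence law: tensoring with the unit object
    is injective on terms, and after tensoring the law follows from the
    pentagon and the triangle, up to an invertible composite of associators
    that is cancelled. *)
Lemma lunit_tensor A B :
  Lunit (A ** B) \oo Assoc I A B === Lunit A *** Id B.
Proof.
apply: unit_tensor_inj.
have cancel C (f g : term (I ** ((I ** A) ** B)) C) :
    f \oo (Assoc I (I ** A) B \oo (Assoc I I A *** Id B)) ===
    g \oo (Assoc I (I ** A) B \oo (Assoc I I A *** Id B)) -> f === g.
  move=> e.
  have K : (Assoc I (I ** A) B \oo (Assoc I I A *** Id B)) \oo
      ((AssocV I I A *** Id B) \oo AssocV I (I ** A) B) === Id _.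
    rewrite -te_compA (comp_idK (f := AssocV I I A *** Id B)).
      exact: te_assocVK.
    by rewrite -te_tensor_comp te_assocVK te_idl te_tensor_id.
  by rewrite -(te_idr f) -(te_idr g) -K !te_compA
    -!(te_compA _ (Assoc _ _ _)) e.
apply: cancel.
rewrite -[X in X *** _ \oo _](te_idl (Id I)) te_tensor_comp -te_compA.
rewrite -te_pentagon te_compA te_triangle.
rewrite -te_tensor_id te_assoc_nat.
rewrite (comp_eqr (te_assoc_nat _ _ _)) -te_tensor_comp te_triangle te_idl.
by [].
Qed.

(** * Coherence for monoidal categories *)

(** There is no rule for [TM]: objects [T A] are treated as atoms, so that only
    the bracketing outside all occurrences of [T] changes. *)
Inductive structural : forall A B, term A B -> Prop :=
| str_id A : structural (Id A)
| str_comp A B C (g : term B C) (f : term A B) :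
    structural g -> structural f -> structural (g \oo f)
| str_tensor A B C D (f : term A B) (g : term C D) :
    structural f -> structural g -> structural (f *** g)
| str_assoc A B C : structural (Assoc A B C)
| str_assocV A B C : structural (AssocV A B C)
| str_lunit A : structural (Lunit A)
| str_lunitV A : structural (LunitV A)
| str_runit A : structural (Runit A)
| str_runitV A : structural (RunitV A)
| str_eq A B (f g : term A B) : structural f -> f === g -> structural g.

(** The word of [A], prepended to [n].  The accumulator makes both sides of an
    associativity or unit isomorphism have convertible words. *)
Fixpoint flat (A : obj) (n : seq obj) : seq obj :=
  match A with
  | Gen x => Gen x :: n
  | Unit => n
  | A ** B => flat A (flat B n)
  | T A => T A :: n
  end.

Fixpoint emb (n : seq obj) : obj := if n is A :: n' then A ** emb n' else I.

(** Normalisation of brackets as a term: it absorbs the letters of [A] into an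
    already normalised right factor. *)
Fixpoint norm A n : term (A ** emb n) (emb (flat A n)) :=
  match A with
  | Gen x => Id (Gen x ** emb n)
  | Unit => Lunit (emb n)
  | A ** B => norm A (flat B n) \oo ((Id A *** norm B n) \oo Assoc A B (emb n))
  | T A => Id (T A ** emb n)
  end.

Fixpoint normV A n : term (emb (flat A n)) (A ** emb n) :=
  match A with
  | Gen x => Id (Gen x ** emb n)
  | Unit => LunitV (emb n)
  | A ** B =>
      AssocV A B (emb n) \oo ((Id A *** normV B n) \oo normV A (flat B n))
  | T A => Id (T A ** emb n)
  end.

Lemma normK A n : normV A n \oo norm A n === Id (A ** emb n).
Proof.
elim: A n => [x||A IHA B IHB|A _] n /=; try exact: te_idl.
  exact: te_lunitK.
have KB : (Id A *** normV B n) \oo (Id A *** norm B n) === Id _.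
  by rewrite -te_tensor_comp te_idl IHB te_tensor_id.
by rewrite -!te_compA (comp_idK (IHA _)) (comp_idK KB) te_assocK.
Qed.

(** Equal words give equal, though not convertible, objects; as proofs of
    equality are unique, the resulting terms do not depend on the proof. *)
Definition cast n m (e : n = m) : term (emb n) (emb m) :=
  ecast k (term (emb n) (emb k)) e (Id (emb n)).

Lemma cast_comp n m k (e1 : n = m) (e2 : m = k) :
  cast e2 \oo cast e1 === cast (etrans e1 e2).
Proof. by case: k / e2; case: m / e1; apply: te_idl. Qed.

Lemma cast_irr n m (e1 e2 : n = m) : cast e1 = cast e2.
Proof. by rewrite (Prop_irrelevance e1 e2). Qed.

Lemma cast_id n (e : n = n) : cast e = Id (emb n).
Proof. by rewrite (cast_irr e erefl). Qed.

Lemma cast_nat A n m (e : n = m) :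
  norm A m \oo (Id A *** cast e) === cast (congr1 (flat A) e) \oo norm A n.
Proof. by case: m / e; rewrite !cast_id te_tensor_id te_idl te_idr. Qed.

(** Naturality of [norm] with respect to [s], where the arrow between the
    normalised objects is an identity up to transport. *)
Definition coherent A B (s : term A B) := forall n,
  exists e : flat A n = flat B n,
    norm B n \oo (s *** Id (emb n)) === cast e \oo norm A n.

Lemma coherent_inv A B (s : term A B) (t : term B A) :
  s \oo t === Id B -> coherent s -> coherent t.
Proof.
move=> sK cs n; have [e He] := cs n; exists (esym e).
have := te_comp (te_refl (cast (esym e))) He.
rewrite te_compA (te_compA (cast _)) cast_comp cast_id te_idl => {}He.
have := te_comp He (te_refl (t *** Id (emb n))).
by rewrite -te_compA -te_tensor_comp sK te_idl te_tensor_id te_idr => <-.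
Qed.

Lemma coherent_assoc A B C : coherent (Assoc A B C).
Proof.
move=> n; exists erefl; rewrite cast_id te_idl /=.
set nA := norm A _; set nB := norm B _; set nC := norm C _.
have E : Id A *** (nB \oo ((Id B *** nC) \oo Assoc B C (emb n))) ===
    (Id A *** nB) \oo ((Id A *** (Id B *** nC)) \oo
      (Id A *** Assoc B C (emb n))).
  by rewrite -!te_tensor_comp !te_idl.
rewrite E -!te_compA -te_pentagon.
by rewrite (comp_eqr (te_assoc_nat _ _ _)) te_tensor_id.
Qed.

Lemma coherent_lunit A : coherent (Lunit A).
Proof.
move=> n; exists erefl; rewrite cast_id te_idl /=.
by rewrite te_compA -te_lunit_nat -te_compA lunit_tensor.
Qed.

Lemma coherent_runit A : coherent (Runit A).
Proof. by move=> n; exists erefl; rewrite cast_id te_idl /= te_triangle. Qed.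

Lemma structural_coherent A B (s : term A B) : structural s -> coherent s.
Proof.
elim=> {A B s}.
- by move=> A n; exists erefl; rewrite cast_id te_tensor_id te_idl te_idr.
- move=> A B C g f _ IHg _ IHf n; have [e He] := IHf n; have [d Hd] := IHg n.
  exists (etrans e d); rewrite -cast_comp -(te_idl (Id (emb n))).
  by rewrite te_tensor_comp te_compA Hd -!te_compA He.
- move=> A A' B B' f g _ IHf _ IHg n /=.
  have [e He] := IHg n; have [d Hd] := IHf (flat B n).
  exists (etrans d (congr1 (flat A') e)); rewrite -cast_comp.
  rewrite -!te_compA -te_assoc_nat (te_compA (Id A' *** _)).
  rewrite -te_tensor_comp te_idl He -{1}(te_idr f) te_tensor_comp.
  by rewrite -(tensor_idl f (cast e)) -!te_compA (comp_eqr (cast_nat _ _))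
    (comp_eqr Hd).
- exact: coherent_assoc.
- move=> A B C.
  by apply: (coherent_inv (te_assocVK A B C)); apply: coherent_assoc.
- exact: coherent_lunit.
- by move=> A; apply: (coherent_inv (te_lunitVK A)); apply: coherent_lunit.
- exact: coherent_runit.
- by move=> A; apply: (coherent_inv (te_runitVK A)); apply: coherent_runit.
- by move=> A B f g _ IH e n; have [d Hd] := IH n; exists d; rewrite -e.
Qed.

Lemma structural_flat A B (s : term A B) n :
  structural s -> flat A n = flat B n.
Proof. by move/structural_coherent/(_ n) => []. Qed.

(** Both terms become the same transport after normalisation, and [norm] is
    left invertible. *)
Lemma structural_unique A B (s t : term A B) :
  structural s -> structural t -> s === t.
Proof.
move=> /structural_coherent/(_ [::])[e He] /structural_coherent/(_ [::])[d Hd].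
apply: tensor_unit_inj.
rewrite -(te_idl (s *** _)) -(te_idl (t *** _)) -(normK B [::]) -!te_compA.
by rewrite He Hd (cast_irr e d).
Qed.

Lemma norm_structural A n : structural (norm A n) /\ structural (normV A n).
Proof.
elim: A n => [x||A IHA B IHB|A _] n /=; try by split; constructor.
have [? ?] := IHA (flat B n); have [? ?] := IHB n.
by split; do !constructor.
Qed.

Lemma structural_exists A B :
  flat A [::] = flat B [::] -> exists s : term A B, structural s.
Proof.
move=> e; exists (Runit B \oo
  (normV B [::] \oo (cast e \oo (norm A [::] \oo RunitV A)))).
have [? _] := norm_structural A [::]; have [_ ?] := norm_structural B [::].
have ? : structural (cast e) by case: _ / e; constructor.
by do !constructor.
Qed.

Lemma structural_inverse A B (s : term A B) : structural s ->
  exists2 t : term B A, structural t & s \oo t === Id B.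
Proof.
move=> str_s.
have [t str_t] := structural_exists (esym (structural_flat [::] str_s)).
by exists t => //; apply: structural_unique; do ?constructor.
Qed.

(** * Extension along the strength *)

(** Kleisli extension of a map in its last factor; in the word picture it
    merges the last block of the source with the block that is the target. *)
Definition ext A B C (g : term (A ** B) (T C)) : term (A ** T B) (T C) :=
  Mu C \oo (TM g \oo Psi A B).

#[local] Instance ext_proper A B C :
  Proper (@term_eq P (A ** B) (T C) ==> @term_eq P (A ** T B) (T C))
    (@ext A B C).
Proof. by move=> g g' e; rewrite /ext e. Qed.

Lemma ext_eta A B C (g : term (A ** B) (T C)) :
  ext g \oo (Id A *** Eta B) === g.
Proof.
by rewrite /ext -!te_compA te_psi_eta te_eta_nat (comp_idK (te_mu_etaT C)).
Qed.

Lemma ext_pre A A' B B' C (g : term (A ** B) (T C)) (h : term A' A)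
    (k : term B' B) :
  ext g \oo (h *** TM k) === ext (g \oo (h *** k)).
Proof. by rewrite /ext te_T_comp -!te_compA te_psi_nat. Qed.

Lemma eta_ext A B C (f : term (A ** B) C) :
  ext (Eta C \oo f) === TM f \oo Psi A B.
Proof. by rewrite /ext te_T_comp -!te_compA (comp_idK (te_mu_Teta C)). Qed.

(** This and [Mu_ext] present [TM] and [Mu] through [ext]; the unit object
    serves as the missing left factor. *)
Lemma TM_ext A B (f : term A B) :
  ext (Eta B \oo (f \oo Lunit A)) \oo LunitV (T A) === TM f.
Proof.
rewrite eta_ext te_T_comp -!te_compA (comp_eqr1 (te_psi_lunit A)) te_lunitVK.
exact: te_idr.
Qed.

Lemma Mu_ext A : ext (Lunit (T A)) \oo LunitV (T (T A)) === Mu A.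
Proof.
rewrite /ext -!te_compA (comp_eqr1 (te_psi_lunit (T A))) te_lunitVK.
exact: te_idr.
Qed.

Lemma psi_psi (A B C : obj) :
  Psi A (B ** C) \oo (Id A *** Psi B C) ===
  TM (Assoc A B C) \oo (Psi (A ** B) C \oo AssocV A B (T C)).
Proof.
by rewrite (comp_eqr (te_psi_assoc A B C)) -te_compA te_assocVK te_idr.
Qed.

(** The associativity law of Kleisli extension, for the strength.  It is the
    step of cut elimination where both terms are extensions. *)
Lemma ext_ext A A' B C D W (g : term (A ** C) (T D)) (h : term A' A)
    (f : term (B ** W) (T C)) :
  ext g \oo (h *** ext f) ===
  ext (ext g \oo ((h *** f) \oo Assoc A' B W)) \oo AssocV A' B (T W).
Proof.
have -> : h *** ext f ===
    (Id A *** Mu C) \oo ((h *** TM f) \oo (Id A' *** Psi B W)).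
  by rewrite -!te_tensor_comp !te_idl te_idr.
rewrite {1 2}/ext.
rewrite -!te_compA (comp_eqr (te_psi_mu A C)) -!te_compA.
rewrite -(comp_eqr (te_psi_nat h f)) psi_psi.
rewrite (comp_eqr (te_mu_nat _)) (comp_eqr (te_mu_mu _)) /ext !te_T_comp.
by rewrite -!te_compA.
Qed.

(** * Normal terms *)

(** The two last rules for an arrow into [T V], given the normal arrows [Q]
    into [V].  The extended term [g] has again target [T V], whence the
    induction; [s] brings the last block of the source to the right. *)
Inductive normalT V (Q : forall A, term A V -> Prop) :
    forall A, term A (T V) -> Prop :=
| normalT_eta A (f : term A V) h : Q A f -> h === Eta V \oo f -> normalT Q h
| normalT_ext A B W (s : term A (B ** T W)) (g : term (B ** W) (T V)) h :
    structural s -> normalT Q g -> h === ext g \oo s -> normalT Q h.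

(** Recursion on the target: the target of each rule determines which rules
    may come last, while the source is only known up to a structural
    isomorphism. *)
Fixpoint normal B : forall A, term A B -> Prop :=
  match B return forall A, term A B -> Prop with
  | Gen x => fun A f => structural f
  | Unit => fun A f => structural f
  | B1 ** B2 => fun A f => exists A1 A2 (s : term A (A1 ** A2))
      (f1 : term A1 B1) (f2 : term A2 B2),
      [/\ structural s, normal f1, normal f2 & f === (f1 *** f2) \oo s]
  | T V => normalT (@normal V)
  end.

Lemma normal_eq A B (f g : term A B) : f === g -> normal f -> normal g.
Proof.
elim: B A f g => [x||B1 IH1 B2 IH2|V IHV] A f g /=.
- by move=> e sf; apply: str_eq e.
- by move=> e sf; apply: str_eq e.
- move=> e [A1 [A2 [s [f1 [f2 [? ? ? ef]]]]]].
  by exists A1, A2, s, f1, f2; split=> //; rewrite -e.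
- move=> e Df; case: A f / Df g e
    => [A f h Df eh|A B W s g' h str_s Dg' eh] g e.
    by apply: normalT_eta Df _; rewrite -e.
  by apply: normalT_ext str_s Dg' _; rewrite -e.
Qed.

Lemma normal_pre A A' B (f : term A B) (s : term A' A) :
  normal f -> structural s -> normal (f \oo s).
Proof.
elim: B A A' f s => [x||B1 IH1 B2 IH2|V IHV] A A' f s /=.
- by move=> *; constructor.
- by move=> *; constructor.
- move=> [A1 [A2 [t [f1 [f2 [? ? ? ef]]]]]] str_s.
  exists A1, A2, (t \oo s), f1, f2; split=> //; first by constructor.
  by rewrite ef te_compA.
- move=> Df; case: A f / Df s
    => [A f h Df eh|A B W t g' h str_t Dg' eh] s str_s.
    apply: (@normalT_eta _ _ _ (f \oo s)); first exact: IHV.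
    by rewrite eh te_compA.
  apply: (@normalT_ext _ _ _ _ _ (t \oo s) g') => //; first by constructor.
  by rewrite eh te_compA.
Qed.

Lemma normal_id A : normal (Id A).
Proof.
elim: A => [x||A IHA B IHB|A IHA] /=; try by constructor.
- exists A, B, (Id _), (Id A), (Id B); split=> //; first by constructor.
  by rewrite te_tensor_id te_idl.
- apply: (normalT_ext (s := LunitV (T A)) (g := Eta A \oo Lunit A)).
  + by constructor.
  + by apply: normalT_eta (te_refl _); apply: (normal_eq (te_idl _));
      apply: normal_pre => //; constructor.
  + by rewrite -{1}te_T_id -TM_ext te_idl.
Qed.

Lemma normal_tensor A1 A2 B1 B2 (f1 : term A1 B1) (f2 : term A2 B2) :
  normal f1 -> normal f2 -> normal (f1 *** f2).
Proof.
move=> D1 D2; exists A1, A2, (Id _), f1, f2; split=> //; first by constructor.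
by rewrite te_idr.
Qed.

Lemma normal_eta A B (f : term A B) : normal f -> normal (Eta B \oo f).
Proof. by move=> Df; apply: normalT_eta (te_refl _). Qed.

Lemma normal_ext A B C (g : term (A ** B) (T C)) : normal g -> normal (ext g).
Proof.
by move=> Dg; apply: normalT_ext (str_id _) Dg _; rewrite te_idr.
Qed.

Lemma normal_T A B (f : term A B) : normal f -> normal (TM f).
Proof.
move=> Df; apply: (normal_eq (TM_ext f)).
apply: normal_pre; last by constructor.
by apply/normal_ext/normal_eta/normal_pre => //; constructor.
Qed.

(** A structural term rearranges the factors into which the normal term
    already splits. *)
Lemma normal_post A B B' (s : term B B') (f : term A B) :
  structural s -> normal f -> normal (s \oo f).
Proof.
move=> str_s; elim: str_s A f => {B B' s}.
- by move=> B A f Df; apply: (normal_eq (te_sym (te_idl f))).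
- move=> B C E g h _ IHg _ IHh A f Df.
  by apply: (normal_eq (te_compA _ _ _)); apply/IHg/IHh.
- move=> B1 C1 B2 C2 s1 s2 _ IH1 _ IH2 A f [A1 [A2 [t [f1 [f2 [? D1 D2 e]]]]]].
  exists A1, A2, t, (s1 \oo f1), (s2 \oo f2).
  by split=> //; [apply: IH1 | apply: IH2 | rewrite e te_compA te_tensor_comp].
- move=> B1 B2 B3 A f [A' [A3 [t [f' [f3 [str_t
    [A1 [A2 [t' [f1 [f2 [str_t' D1 D2 e']]]]]] D3 e]]]]]].
  exists A1, (A2 ** A3), (Assoc A1 A2 A3 \oo ((t' *** Id A3) \oo t)),
    f1, (f2 *** f3).
  split=> //; first by do !constructor.
    exact: normal_tensor.
  rewrite e e' -{1}(te_idr f3) te_tensor_comp -!te_compA.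
  by rewrite (comp_eqr (te_assoc_nat f1 f2 f3)).
- move=> B1 B2 B3 A f [A1 [A' [t [f1 [f' [str_t D1
    [A2 [A3 [t' [f2 [f3 [str_t' D2 D3 e']]]]]] e]]]]]].
  exists (A1 ** A2), A3, (AssocV A1 A2 A3 \oo ((Id A1 *** t') \oo t)),
    (f1 *** f2), f3.
  split=> //; first by do !constructor.
    exact: normal_tensor.
  rewrite e e' -{1}(te_idr f1) te_tensor_comp -!te_compA.
  rewrite -{1}(comp_idK (te_assocVK A1 A2 A3) (_ \oo t)).
  by rewrite (comp_eqr (te_assoc_nat f1 f2 f3)) (comp_idK (te_assocK _ _ _)).
- move=> B A f [A1 [A2 [t [f1 [f2 [str_t s1 D2 e]]]]]].
  apply: (normal_eq (f := f2 \oo (Lunit A2 \oo ((f1 *** Id A2) \oo t)))).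
    rewrite e (comp_eqr (te_lunit_nat f2)).
    by rewrite (comp_eqr1 (tensor_idl f1 f2)).
  by apply: normal_pre => //; do !constructor.
- move=> B A f Df.
  exists I, A, (LunitV A), (Id I), f; split=> //; try by constructor.
  by rewrite -{1}(te_idr f) -(te_lunitVK A) (te_compA f) te_lunit_nat
    -!te_compA (comp_idK (te_lunitK B)).
- move=> B A f [A1 [A2 [t [f1 [f2 [str_t D1 s2 e]]]]]].
  apply: (normal_eq (f := f1 \oo (Runit A1 \oo ((Id A1 *** f2) \oo t)))).
    rewrite e (comp_eqr (te_runit_nat f1)).
    by rewrite (comp_eqr1 (tensor_idr f1 f2)).
  by apply: normal_pre => //; do !constructor.
- move=> B A f Df.
  exists A, I, (RunitV A), f, (Id I); split=> //; try by constructor.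
  by rewrite -{1}(te_idr f) -(te_runitVK A) (te_compA f) te_runit_nat
    -!te_compA (comp_idK (te_runitK B)).
- by move=> B C g g' _ IH e A f Df; apply: normal_eq (IH _ _ Df); rewrite e.
Qed.

(** Cut elimination, by induction on the target.  When [g] is an extension of
    a term on [B' ** W], the arrow into [B' ** T W] that precedes it splits as
    [f1 *** f2], and an induction on the normal form of [f2] finishes: an
    [Eta] cancels against the extension, and an extension merges with it. *)
Lemma normal_comp A B C (g : term B C) (f : term A B) :
  normal g -> normal f -> normal (g \oo f).
Proof.
elim: C A B g f => [x||C1 IH1 C2 IH2|V IHV] A B g f /=.
- exact: (@normal_post A B (Gen x)).
- exact: (@normal_post A B I).
- move=> [B1 [B2 [s [g1 [g2 [str_s Dg1 Dg2 eg]]]]]] Df.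
  have [A1 [A2 [t [f1 [f2 [str_t Df1 Df2 ef]]]]]] := normal_post str_s Df.
  exists A1, A2, t, (g1 \oo f1), (g2 \oo f2).
  split=> //; [exact: IH1 | exact: IH2 |].
  by rewrite eg -te_compA ef te_compA te_tensor_comp.
- move=> Dg; elim: Dg A f
    => {B g} [B g h Dg eh|B B' W s g h str_s _ IHg eh] A f Df.
    apply: (normalT_eta (f := g \oo f)); first exact: IHV.
    by rewrite eh te_compA.
  have [A1 [A2 [t [f1 [f2 [str_t Df1 Df2 ef]]]]]] := normal_post str_s Df.
  suff DE : normalT (@normal V) (ext g \oo (f1 *** f2)).
    apply: (normal_eq (B := T V) (f := (ext g \oo (f1 *** f2)) \oo t)).
      by rewrite eh -!te_compA ef.
    exact: (normal_pre (B := T V)).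
  move=> {A f Df t str_t ef}; elim: Df2
      => {A2 f2} [A2 f2 k Df2 ek|A2 A3 W2 s2 f2 k ss2 _ IHf ek].
    apply: (normal_eq (B := T V) (f := g \oo (f1 *** f2))).
      by rewrite ek tensor_compr te_compA ext_eta.
    exact/IHg/normal_tensor.
  apply: (normalT_ext (B := A1 ** A3) (W := W2)
    (g := ext g \oo ((f1 *** f2) \oo Assoc A1 A3 W2))
    (s := AssocV A1 A3 (T W2) \oo (Id A1 *** s2))).
  + by do !constructor.
  + apply: (normal_eq (B := T V) (te_sym (te_compA _ _ _))).
    by apply: (normal_pre (B := T V)); [exact: IHf | constructor].
  + by rewrite ek -{1}(te_idr f1) te_tensor_comp te_compA ext_ext -te_compA.
Qed.

Lemma term_normal A B (f : term A B) : normal f.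
Proof.
have str_normal X Y (s : term X Y) : structural s -> normal s.
  by move=> str_s; apply: (normal_eq (te_idr s));
    apply: normal_post (normal_id X).
elim: f => {A B}; try by move=> *; apply: str_normal; constructor.
- by move=> A B C g Dg f Df; apply: normal_comp.
- by move=> A B C E f Df g Dg; apply: normal_tensor.
- by move=> A B f; apply: normal_T.
- by move=> A; apply: (normal_eq (te_idr _)); apply/normal_eta/normal_id.
- move=> A; apply: (normal_eq (Mu_ext A)).
  apply: normal_pre; last by constructor.
  apply: normal_ext; apply: (normal_eq (te_idl _)).
  apply: normal_pre; last by constructor.
  exact: (normal_id (T A)).
- move=> A B; apply: (normal_eq (f := ext (Eta (A ** B) \oo Id _))).
    by rewrite eta_ext te_T_id te_idl.
  by apply/normal_ext/normal_eta/normal_id.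
Qed.

(** * The functor determines normal terms *)

Definition sameG A B (f g : term A B) :=
  forall i, i < Gob A -> Gval f i = Gval g i.

Lemma sameG_eqv A B (f f' g g' : term A B) :
  f === f' -> g === g' -> sameG f g -> sameG f' g'.
Proof.
move=> ef eg fg i lti.
by rewrite -(Gval_eq ef lti) -(Gval_eq eg lti) fg.
Qed.

Lemma sameG_pre A B C (f g : term B C) (h : term A B) :
  sameG f g -> sameG (f \oo h) (g \oo h).
Proof. by move=> fg i lti /=; apply/fg/Gval_lt. Qed.

Lemma structural_G A B (s : term A B) : structural s ->
  Gob A = Gob B /\ forall i, i < Gob A -> Gval s i = i.
Proof.
elim=> {A B s} /=; try by move=> *; split=> //; lia.
- move=> A B C g f _ [gB Hg] _ [fB Hf].
  by split=> [|i lti]; rewrite ?Hf ?Hg; lia.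
- move=> A B C E f g _ [fB Hf] _ [gB Hg]; split=> [|i lti]; first lia.
  by case: ltnP => lt; [apply: Hg | rewrite Hf; lia].
- by move=> A B f g _ [fB Hf] e; split=> // i lti; rewrite -(Gval_eq e) ?Hf.
Qed.

(** Generators are counted along with occurrences of [T] because a letter of a
    word may contain only one of the two kinds; [weight] is then positive on
    every letter. *)
Fixpoint gens (A : obj) : nat :=
  match A with
  | Gen _ => 1
  | Unit => 0
  | A ** B => gens A + gens B
  | T A => gens A
  end.

Lemma gens_term A B (f : term A B) : gens A = gens B.
Proof. by elim: f => /=; lia. Qed.

Definition weight A := Gob A + gens A.

Lemma flat_cat A n : flat A n = flat A [::] ++ n.
Proof.
elim: A n => [x||A IHA B IHB|A _] n //=.
by rewrite IHA IHB catA -IHA.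
Qed.

Lemma flat_weight A n :
  sumn (map weight (flat A n)) = weight A + sumn (map weight n).
Proof.
by elim: A n => [x||A IHA B IHB|A _] n //=; rewrite ?IHA ?IHB /weight /=; lia.
Qed.

Definition positive (n : seq obj) := all (fun A => 0 < weight A) n.

Lemma flat_positive A n : positive n -> positive (flat A n).
Proof.
by elim: A n => [x||A IHA B IHB|A _] n pn /=; rewrite ?IHA ?IHB.
Qed.

(** Two suffixes of a word are nested, and letters have positive weight; so a
    splitting of a word is determined by the weight of its second part. *)
Lemma cat_weight_inj (s1 s2 t1 t2 : seq obj) :
  positive (s1 ++ s2) -> positive (t1 ++ t2) -> s1 ++ s2 = t1 ++ t2 ->
  sumn (map weight s2) = sumn (map weight t2) -> s1 = t1 /\ s2 = t2.
Proof.
elim: s1 t1 => [|A s1 IH] [|B t1] //=.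
- by move=> _ /andP[p _] ->; rewrite /= map_cat sumn_cat; lia.
- by move=> /andP[p _] _ <-; rewrite /= map_cat sumn_cat; lia.
- move=> /andP[_ ps] /andP[_ pt] [-> e] w.
  by have [-> ->] := IH _ ps pt e w.
Qed.

Lemma flat_tensor_inj A1 A2 B1 B2 :
  flat (A1 ** A2) [::] = flat (B1 ** B2) [::] -> weight A2 = weight B2 ->
  flat A1 [::] = flat B1 [::] /\ flat A2 [::] = flat B2 [::].
Proof.
rewrite /= (flat_cat A1) (flat_cat B1) => e w.
apply: cat_weight_inj => //; last by rewrite !flat_weight w.
  by rewrite -flat_cat; do 2!apply: flat_positive.
by rewrite -flat_cat; do 2!apply: flat_positive.
Qed.

(** The outermost [T] of the target has number [Gob V], which is not in the
    image of [Eta V \oo f]; so [G] distinguishes the two rules for [T V]. *)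
Lemma ext_top A B V W (g : term (B ** W) (T V)) (s : term A (B ** T W)) :
  structural s -> Gob W < Gob A /\ Gval (ext g \oo s) (Gob W) = Gob V.
Proof.
move=> /structural_G[eA Gs]; have lti : Gob W < Gob A by rewrite eA /=; lia.
by split=> //; rewrite [LHS]/= Gs // !ltnn eqxx !ltnn.
Qed.

(** [G] sees the splitting: the occurrences of [T] in the second factor of the
    source are those sent into the second factor of the target. *)
Lemma tensor_Gob A1 A2 B1 B2 (f1 : term A1 B1) (f2 : term A2 B2) i :
  i < Gob (A1 ** A2) -> (Gval (f1 *** f2) i < Gob B2) = (i < Gob A2).
Proof.
move=> /= lti; have := @Gval_lt _ _ _ f2 i.
by case: (ltnP i) => [_ ->|] //; lia.
Qed.

Lemma sameG_tensor A1 A2 B1 B2 (f1 g1 : term A1 B1) (f2 g2 : term A2 B2) :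
  sameG (f1 *** f2) (g1 *** g2) -> sameG f1 g1 /\ sameG f2 g2.
Proof.
move=> e; split=> i lti.
- have /= := e (i + Gob A2); rewrite ltn_add2r => /(_ lti).
  by rewrite ltnNge leq_addl addnK /= => /addIn.
- by have /= := e i; rewrite lti; apply; lia.
Qed.

(** Induction on the target, and for [T V] on the normal form of [f].  The
    two last rules agree, and the sources of their premises have the same words,
    hence are identified by a structural term.  The premises agree under [G]
    because composition recovers them from the conclusions. *)
Lemma normal_unique A B (f g : term A B) :
  normal f -> normal g -> sameG f g -> f === g.
Proof.
elim: B A f g => [x||B1 IH1 B2 IH2|V IHV] A f g.
- by move=> sf sg _; apply: structural_unique.
- by move=> sf sg _; apply: structural_unique.
- move=> [A1 [A2 [s [f1 [f2 [str_s Df1 Df2 ef]]]]]].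
  move=> [A1' [A2' [t [g1 [g2 [str_t Dg1 Dg2 eg]]]]]] fg.
  have {}fg := sameG_eqv ef eg fg.
  have [As Gs] := structural_G str_s; have [At Gt] := structural_G str_t.
  (* [f] and [g] split the source at the same place, given by [Gob]. *)
  have cut i : i < Gob A -> (i < Gob A2) = (i < Gob A2').
    move=> lti; rewrite -(tensor_Gob f1 f2) -?As // -(tensor_Gob g1 g2) -?At //.
    by have := fg i lti; rewrite /= Gs // Gt // => ->.
  have cutA : Gob A2 = Gob A2'.
    have := cut (Gob A2); have := cut (Gob A2').
    by move: As At => /=; rewrite !ltnn; lia.
  have [e1 e2] : flat A1 [::] = flat A1' [::] /\ flat A2 [::] = flat A2' [::].
    apply: flat_tensor_inj; first by rewrite -(structural_flat _ str_s)
      (structural_flat _ str_t).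
    by rewrite /weight cutA (gens_term f2) (gens_term g2).
  have [r1 sr1] := structural_exists e1; have [r2 sr2] := structural_exists e2.
  have et : t === (r1 *** r2) \oo s.
    by apply: structural_unique => //; do !constructor.
  have [u su us] := structural_inverse str_s.
  have [h1 h2] : sameG f1 (g1 \oo r1) /\ sameG f2 (g2 \oo r2).
    apply: sameG_tensor; apply: sameG_eqv (sameG_pre u fg).
      by rewrite -te_compA us te_idr.
    by rewrite et -!te_compA us te_idr te_tensor_comp.
  rewrite ef eg et te_compA -te_tensor_comp.
  have -> : f1 === g1 \oo r1 by apply: IH1 => //; apply: normal_pre.
  by have -> : f2 === g2 \oo r2 by apply: IH2 => //; apply: normal_pre.
- move=> Df; elim: Df g => {A f} [A f h Df eh|A B W s f h str_s Df IH eh] k Dk.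
  + case: A k / Dk f h Df eh
      => [A g k Dg ek|A B W t g k str_t Dg ek] f h Df eh fg.
      have {}fg := sameG_eqv eh ek fg.
      by rewrite eh ek (IHV _ _ _ Df Dg).
    have [lti top] := ext_top g str_t.
    have := sameG_eqv eh ek fg lti; rewrite top /=.
    by have := Gval_lt f lti; lia.
  + case: A k / Dk s h str_s eh
      => [A g k Dg ek|A B' W' t g k str_t Dg ek] s h str_s eh fg.
      have [lti top] := ext_top f str_s.
      have := sameG_eqv eh ek fg lti; rewrite top /=.
      by have := Gval_lt g lti; lia.
    have {}fg := sameG_eqv eh ek fg.
    (* Both extended blocks are the last letter of the word of [A]. *)
    have e : flat B [::] ++ [:: T W] = flat B' [::] ++ [:: T W'].
      rewrite -!flat_cat; have := structural_flat [::] str_s.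
      by rewrite (structural_flat [::] str_t) /= => ->.
    move: e; rewrite !cats1 => /rcons_inj [eB eW].
    case: W' / eW t g str_t Dg ek fg => t g str_t Dg ek fg.
    have [r sr] := structural_exists eB.
    have et : t === (r *** Id (T W)) \oo s.
      by apply: structural_unique => //; do !constructor.
    have eg : ext g \oo t === ext (g \oo (r *** Id W)) \oo s.
      by rewrite et te_compA -te_T_id ext_pre.
    have -> : h === ext f \oo s by [].
    rewrite ek eg.
    have [u su us] := structural_inverse str_s.
    suff -> : f === g \oo (r *** Id W) by [].
    apply: IH; first by apply: (normal_pre (B := T V)) => //; do !constructor.
    apply: sameG_eqv (sameG_pre (u \oo (Id B *** Eta W)) fg).
      by rewrite -te_compA (comp_idK us) ext_eta.
    by rewrite eg -te_compA (comp_idK us) ext_eta.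
Qed.

End Faithfulness.

Theorem mainTheorem2 (P : Type) : faithful (G P).
Proof.
move=> A B f g /= fg; rewrite -(repK f) -(repK g); apply/classP.
apply: normal_unique; try exact: term_normal.
by move=> i lti; have /ffunP/(_ (Ordinal lti)) := fg; rewrite !ffunE => -[].
Qed.
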